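(* Let $F$ be a free group and $H$ a finitely generated subgroup of $F$. If $H$ is an S-subgroup of $F$, then $H$ does not have ACEP in $F$.
   Context: For a group $K$ and $w\in K$, $w^K=\{k^{-1}wk\mid k\in K\}$ is the conjugacy class of $w$ in $K$. A subgroup $H<F$ is an S-subgroup of $F$ if there exists $w\in H$ such that $w^H\ne w^F\cap H$. A subgroup $H$ of $F$ has ACEP (Almost Congruence Extension Property) in $F$ if there is a finite set $\Phi\subset H$ of nontrivial elements such that for every normal subgroup $N$ of $H$ with $N\cap\Phi=\emptyset$ one has $H\cap\langle\langle N\rangle\rangle_F=N$, where $\langle\langle N\rangle\rangle_F$ is the normal closure of $N$ in $F$. *)

(* Defs.v *)
From mathcomp Require Import all_boot.
From mathcomp Require Import boolp classical_sets functions cardinality.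

Set Implicit Arguments.
Unset Strict Implicit.
Unset Printing Implicit Defensive.

Local Open Scope classical_set_scope.
Local Open Scope group_scope.

(* Universal property of a basis [X]; a map [X -> G] is given as the restriction
   to [X] of a function defined on all of [F]. *)
Definition is_basis (F : groupType) (X : set F) : Prop :=
  forall (G : groupType) (f : F -> G),
    exists! phi : F -> G, {morph phi : x y / x * y} /\ {in X, phi =1 f}.

Definition is_free (F : groupType) : Prop := exists X : set F, is_basis X.

Section Subgroups.
Variable F : groupType.
Implicit Types H K N A : set F.

(* Subgroups of [F], and subgroups of those, are all subsets of [F]. *)
Definition is_subgroup H : Prop := group_closed [in H].

Definition finitely_generated H : Prop :=
  exists2 A, finite_set A & H = smallest is_subgroup A.

Definition is_normal_subgroup K N : Prop :=
  [/\ is_subgroup N, N `<=` K & forall x k, N x -> K k -> N (x ^ k)].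

Definition normal_closure A : set F := smallest (is_normal_subgroup setT) A.

(* [w ^ k] is the conjugate [k^-1 * w * k]. *)
Definition conj_class K (w : F) : set F := [set w ^ k | k in K].

Definition S_subgroup H : Prop :=
  exists2 w, H w & conj_class H w <> conj_class setT w `&` H.

Definition ACEP H : Prop :=
  exists Phi : set F,
    [/\ finite_set Phi, Phi `<=` H, ~ Phi 1 &
      forall N, is_normal_subgroup H N -> N `&` Phi = set0 ->
        H `&` normal_closure N = N].

End Subgroups.

(* Main.v *)
Require Import Defs.
From HB Require Import structures.
From mathcomp Require Import all_boot.
From mathcomp Require Import fingroup perm cyclic ssralg ssrint.
From mathcomp Require Import boolp classical_sets functions cardinality.
From mathcomp Require Import zify.

(** Let [u = w ^ f] lie in [H] without being conjugate to [w] in [H], and write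
    [w = rho^e ^ c], [u = rho^e ^ d] with [d = c f] and [rho] the value of a
    cyclically reduced word that is not a proper power. The cosets [H c^-1] and
    [H d^-1] then lie in different [rho]-orbits of [H \ F]. It suffices to find
    a normal subgroup [N] of [H] that avoids the given finite set and contains
    [w^n] but not [u^n] for some [n].

    Residual finiteness gives a finite quotient [q] of [F] in which the given
    finite set survives and so do finitely many commutators with [rho]. Put
    [K := H] intersected with [ker q], and label the edges of the Schreier graph
    [K \ F] by permutations of the integers: the edge leaving [K d^-1] along the
    first letter of [rho] by the reflection [i -> - i], the one leaving
    [K d^-1 rho] by [i -> 1 - i], and all other edges by the identity. The
    [rho]-cycle through [K d^-1] crosses each labelled edge once, so its holonomy
    is a translation, of infinite order. By the choice of [q], no [rho]-path from
    a lift of [H c^-1] meets both labelled edges, so its holonomy has order at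
    most 2. Let [N] be the set of elements of [K] with trivial holonomy at all
    vertices over [H]. *)

Set Implicit Arguments.
Unset Strict Implicit.
Unset Printing Implicit Defensive.

(** * Words *)

Section WordPowers.
Variable A : eqType.
Implicit Types u v t : seq A.

Definition wpow t n := flatten (nseq n t).

Lemma wpowS t n : wpow t n.+1 = t ++ wpow t n. Proof. by []. Qed.

Lemma wpowD t m n : wpow t (m + n) = wpow t m ++ wpow t n.
Proof. by elim: m => [|m IH] //; rewrite addSn !wpowS IH catA. Qed.

Lemma wpowSr t n : wpow t n.+1 = wpow t n ++ t.
Proof. by rewrite -addn1 wpowD /wpow /= cats0. Qed.

Lemma size_wpow t n : size (wpow t n) = n * size t.
Proof. by elim: n => [|n IH] //; rewrite wpowS size_cat IH mulSn. Qed.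

(** Euclid's algorithm on lengths: the shorter word is a prefix of the longer one, and cancelling it
    leaves a shorter commuting pair. *)
Lemma commuting_words u v :
  u ++ v = v ++ u -> exists t i j, u = wpow t i /\ v = wpow t j.
Proof.
have [n] := ubnP (size u + size v); elim: n u v => [//|n IH] u v.
wlog le_uv : u v / size u <= size v.
  move=> th; case: (leqP (size u) (size v)) => [|/ltnW] le h e; first exact: th.
  by have [||t [i [j []]]] := th v u le; [rewrite addnC|exact/esym|exists t, j, i].
case: u le_uv => [|a u] le_uv hn e.
  by exists v, 0, 1; rewrite /wpow /= cats0.
have ev : v = (a :: u) ++ drop (size (a :: u)) v.
  have /(congr1 (take (size (a :: u)))) := e.
  rewrite take_size_cat // takel_cat // => {1}->.
  by rewrite cat_take_drop.
move: (drop _ v) ev => v' ev; subst v.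
have [|| t [i [j [e1 e2]]]] := IH (a :: u) v'.
- by move: hn; rewrite size_cat /=; lia.
- by move/eqP: e; rewrite -catA eqseq_cat // eqxx => /eqP.
by exists t, i, (i + j); rewrite wpowD -e1 -e2.
Qed.

(** Copies of [r] are stripped off [v]; a nonempty remainder shorter than [r] would give a
    nontrivial rotation fixing [r]. *)
Lemma primitive_commute r v :
    (forall a, 0 < a < size r -> drop a r ++ take a r <> r) ->
  r <> [::] -> v ++ r = r ++ v -> exists j, v = wpow r j.
Proof.
move=> prim r0; have [n] := ubnP (size v); elim: n v => [//|n IH] v hn e.
have [le|lt] := leqP (size r) (size v).
  have ev : v = r ++ drop (size r) v.
    have /(congr1 (take (size r))) := e.
    rewrite takel_cat // take_size_cat // => {1}<-.
    by rewrite cat_take_drop.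
  move: (drop _ v) ev => v' ev; subst v.
  have [||j ->] := IH v'; last by exists j.+1.
  - by case: (r) r0 hn => // a s _; rewrite size_cat /=; lia.
  - by move/eqP: e; rewrite -catA eqseq_cat // eqxx => /eqP.
have /(congr1 (take (size v))) := e.
rewrite take_size_cat // takel_cat 1?ltnW // => ev.
have [v0|v0] := posnP (size v).
  by exists 0; rewrite (size0nil v0).
have /prim[]: 0 < size v < size r by rewrite v0.
apply/eqP; rewrite -{3}(cat_take_drop (size v) r) -ev.
move/eqP: e; rewrite -{1 2}(cat_take_drop (size v) r) -ev -catA.
by rewrite eqseq_cat // eqxx eq_sym => /eqP ->.
Qed.

End WordPowers.

(** * Reduced words over an alphabet with formal inverses *)

Section ReducedWords.
Variable T : eqType.
Implicit Types (l a b : T * bool) (u v w r : seq (T * bool)).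

Definition linv l := (l.1, ~~ l.2).

Definition noncancelling a b := b != linv a.

Definition reduced w := sorted noncancelling w.

Definition winv w := rev (map linv w).

Lemma linvK : involutive linv.
Proof. by case=> x b; rewrite /linv /= negbK. Qed.

Lemma linv_neq l : linv l != l.
Proof. by apply/eqP; case: l => x []. Qed.

Lemma winv_cat u v : winv (u ++ v) = winv v ++ winv u.
Proof. by rewrite /winv map_cat rev_cat. Qed.

Lemma size_winv w : size (winv w) = size w.
Proof. by rewrite size_rev size_map. Qed.

Lemma reduced_winv w : reduced (winv w) = reduced w.
Proof.
rewrite /reduced /winv rev_sorted sorted_map; apply: eq_sorted => a b /=.
by rewrite /noncancelling linvK eq_sym.
Qed.

Lemma reduced_rcons_cons u a b v :
  reduced (rcons u a ++ b :: v) =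
  [&& reduced (rcons u a), noncancelling a b & reduced (b :: v)].
Proof.
case: u => [|c u] //=.
by rewrite /reduced cat_path last_rcons.
Qed.

Lemma reduced_catl u v : reduced (u ++ v) -> reduced u.
Proof. by case: u => [|a u] //; rewrite /reduced /= cat_path => /andP[]. Qed.

Lemma reduced_catr u v : reduced (u ++ v) -> reduced v.
Proof.
case: v => [|b v] //; case/lastP: u => [|u a] //.
by rewrite reduced_rcons_cons => /and3P[].
Qed.

Lemma reduced_take n w : reduced w -> reduced (take n w).
Proof. by rewrite -{1}(cat_take_drop n w); apply: reduced_catl. Qed.

Lemma reduced_drop n w : reduced w -> reduced (drop n w).
Proof. by rewrite -{1}(cat_take_drop n w); apply: reduced_catr. Qed.

Lemma reduced_glue u b v v' :
  reduced (u ++ b :: v) -> reduced (b :: v') -> reduced (u ++ b :: v').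
Proof.
case/lastP: u => [|u a] //.
by rewrite !reduced_rcons_cons => /and3P[-> -> _] ->.
Qed.

Lemma reduced_wpow r n : reduced (r ++ r) -> reduced (wpow r n).
Proof.
move=> rr; elim: n => [|[|n] IH] //.
  by rewrite wpowS /wpow /= cats0; apply: reduced_catl rr.
by rewrite wpowS; move: IH rr; rewrite wpowS; case: r => [|b r] // IH /reduced_glue; apply.
Qed.

(** The outer letters of such a word are inverse to each other, and stripping them leaves a word of
    the same kind. This ends with one letter, which is never its own inverse, or with two letters
    that cancel. *)
Lemma reduced_winv_id v : reduced v -> winv v = v -> v = [::].
Proof.
have [n] := ubnP (size v); elim: n v => [//|n IH] [//|a v].
case/lastP: v => [|v b] hn hr.
  by rewrite /winv /= /rev /= => -[] /eqP; rewrite (negbTE (linv_neq a)).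
rewrite -cat1s -cats1 !winv_cat -catA /= => -[eb].
rewrite (_ : winv [:: a] = [:: linv a]) // !cats1 => /(@rcons_inj _ _ _ _ _)[ev _].
move: hr; rewrite -rcons_cons; case: v hn ev => [|c v] hn ev.
  by rewrite /reduced /= /noncancelling -eb linvK eqxx.
move=> hr; suff: c :: v = [::] by [].
apply: IH ev; first by move: hn; rewrite /= size_rcons /=; lia.
by move: hr; rewrite -cats1 => /reduced_catl; rewrite -cat1s => /reduced_catr.
Qed.

(** Comparing lengths, both [drop n r] and [take n r] would be their own inverses, hence empty. *)
Lemma winv_rot_neq r n :
  r <> [::] -> reduced r -> winv r <> drop n r ++ take n r.
Proof.
move=> r0 hr; rewrite -{1}(cat_take_drop n r) winv_cat => /eqP.
rewrite eqseq_cat ?size_winv // => /andP[/eqP e1 /eqP e2].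
have n1 := reduced_winv_id (reduced_drop n hr) e1.
have n2 := reduced_winv_id (reduced_take n hr) e2.
by case: r0; rewrite -(cat_take_drop n r) n1 n2.
Qed.

Lemma cancelling_split w :
  ~~ reduced w -> exists u v a, w = u ++ a :: linv a :: v.
Proof.
elim: w => [|a w IH] //; case: w IH => [|b w] // IH.
rewrite /reduced /= negb_and => /orP[|/IH[u [v [c ->]]]].
  by rewrite negbK => /eqP ->; exists [::], w, a.
by exists (a :: u), v, c.
Qed.

End ReducedWords.

Local Open Scope group_scope.

(** * Groups with a basis *)

Section Bijections.
Variable T : Type.

Record bijection := Bijection {
  bij_fun :> T -> T;
  bij_inv : T -> T;
  bij_funK : cancel bij_fun bij_inv;
  bij_invK : cancel bij_inv bij_fun }.

Lemma bij_eq (f g : bijection) : f =1 g -> f = g.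
Proof.
case: f g => [f f' fK f'K] [g g' gK g'K] /= fg.
have {fg} e : f = g by apply/funext.
subst g; have e : f' = g' by apply/funext => x; rewrite -{1}(g'K x) fK.
by subst g'; congr Bijection; apply: Prop_irrelevance.
Qed.

HB.instance Definition _ := gen_eqMixin bijection.
HB.instance Definition _ := gen_choiceMixin bijection.

Definition bij_one := @Bijection id id (fun=> erefl) (fun=> erefl).

Definition bij_opp (f : bijection) := Bijection (@bij_invK f) (@bij_funK f).

(* Composition is in diagrammatic order, so that a morphism into [bijection] is
   a right action. *)
Definition bij_mul (f g : bijection) :=
  Bijection (can_comp (@bij_funK g) (@bij_funK f))
            (can_comp (@bij_invK f) (@bij_invK g)).

Lemma bij_mulA : associative bij_mul.
Proof. by move=> f g h; apply: bij_eq. Qed.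

Lemma bij_mul1g : left_id bij_one bij_mul.
Proof. by move=> f; apply: bij_eq. Qed.

Lemma bij_mulg1 : right_id bij_one bij_mul.
Proof. by move=> f; apply: bij_eq. Qed.

Lemma bij_mulVg : left_inverse bij_one bij_opp bij_mul.
Proof. by move=> f; apply: bij_eq => x /=; rewrite bij_invK. Qed.

Lemma bij_mulgV : right_inverse bij_one bij_opp bij_mul.
Proof. by move=> f; apply: bij_eq => x /=; rewrite bij_funK. Qed.

HB.instance Definition _ := isGroup.Build bijection
  bij_mulA bij_mul1g bij_mulg1 bij_mulVg bij_mulgV.

End Bijections.

Section PartialPermutations.
Variables (T : finType) (A : {set T}) (f : T -> T).

(** The complements of [A] and of its image have the same size, so their enumerations can be
    matched. The default of [nth] is never reached. *)
Lemma extend_to_perm :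
  {in A &, injective f} -> exists s : {perm T}, {in A, s =1 f}.
Proof.
move=> injf; pose B := (f @: A)%SET.
have size_eq : size (enum (~: A)%SET) = size (enum (~: B)%SET).
  by rewrite -!cardE [LHS]cardsCs [RHS]cardsCs !finset.setCK card_in_imset.
pose g x := if x \in A then f x
            else nth x (enum (~: B)%SET) (index x (enum (~: A)%SET)).
have idx x : x \notin A -> index x (enum (~: A)%SET) < size (enum (~: B)%SET).
  by move=> xA; rewrite -size_eq index_mem mem_enum inE.
have gA x : (g x \in B) = (x \in A).
  rewrite /g; case: ifPn => [xA|xA]; first exact: imset_f.
  by apply/negbTE; rewrite -finset.in_setC -mem_enum mem_nth ?idx.
have injg : injective g.
  move=> x y e; have := gA x; rewrite e gA; move: e; rewrite /g.
  case: ifPn => xA; case: ifPn => yA // e _; first exact: injf.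
  have /eqP := e; rewrite (set_nth_default x y) ?idx // nth_uniq ?enum_uniq ?idx //.
  move/eqP => ei; rewrite -(nth_index x (_ : x \in enum (~: A)%SET)) ?mem_enum ?inE //.
  by rewrite ei nth_index // mem_enum inE.
by exists (perm injg) => x xA; rewrite permE /g xA.
Qed.

End PartialPermutations.

Section Morphisms.
Variables (F G : groupType) (phi : F -> G).
Hypothesis phiM : {morph phi : x y / x * y}.

Lemma morph1 : phi 1 = 1.
Proof. by apply: (mulgI (phi 1)); rewrite -phiM !mulg1. Qed.

Lemma morphV : {morph phi : x / x^-1}.
Proof. by move=> x; apply: (mulgI (phi x)); rewrite -phiM !mulgV morph1. Qed.

Lemma morphX n : {morph phi : x / x ^+ n}.
Proof. by move=> x; elim: n => [|n IH]; rewrite ?morph1 // !expgS phiM IH. Qed.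

End Morphisms.

(** * Values of words, and generation by a basis *)

Section FreeGroups.
Variables (F : groupType) (X : set F).
Implicit Types (g h x : F) (l : F * bool) (u v w : seq (F * bool)).

Definition letter_val l := if l.2 then l.1 else l.1^-1.

Definition word_val w := \prod_(l <- w) letter_val l.

Definition word_over w := all (fun l => l.1 \in X) w.

Lemma letter_valV l : letter_val (linv l) = (letter_val l)^-1.
Proof. by case: l => x []; rewrite /letter_val //= invgK. Qed.

Lemma word_val_nil : word_val [::] = 1.
Proof. exact: big_nil. Qed.

Lemma word_val_cons l w : word_val (l :: w) = letter_val l * word_val w.
Proof. exact: big_cons. Qed.

Lemma word_val_cat u v : word_val (u ++ v) = word_val u * word_val v.
Proof. exact: big_cat. Qed.

Lemma word_val_winv w : word_val (winv w) = (word_val w)^-1.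
Proof.
elim: w => [|l w IH]; first by rewrite word_val_nil invg1.
rewrite -cat1s winv_cat !word_val_cat invgM IH.
by rewrite /winv /= /word_val !big_seq1 letter_valV.
Qed.

Lemma word_val_wpow w n : word_val (wpow w n) = word_val w ^+ n.
Proof.
elim: n => [|n IH]; first exact: word_val_nil.
by rewrite wpowS word_val_cat IH expgS.
Qed.

Lemma word_over_cat u v : word_over (u ++ v) = word_over u && word_over v.
Proof. exact: all_cat. Qed.

Lemma word_over_winv w : word_over (winv w) = word_over w.
Proof. by rewrite /word_over all_rev all_map. Qed.

Hypothesis basisX : is_basis X.

Lemma basis_extend (G : groupType) (f : F -> G) :
  exists phi : F -> G, {morph phi : x y / x * y} /\ {in X, phi =1 f}.
Proof. by have [phi [h _]] := basisX f; exists phi. Qed.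

Lemma basis_unique (G : groupType) (phi psi : F -> G) :
    {morph phi : x y / x * y} -> {morph psi : x y / x * y} ->
  {in X, phi =1 psi} -> phi = psi.
Proof.
move=> phiM psiM e; have [chi [_ u]] := basisX psi.
by rewrite -(u phi) // -(u psi).
Qed.

Definition regular_bij g : bijection (F * bool).
Proof.
by exists (fun p => (p.1 * g, p.2)) (fun p => (p.1 * g^-1, p.2)) => -[h b] /=;
  rewrite ?mulgK ?mulgVK.
Defined.

Definition toggle_bij (S : F -> bool) : bijection (F * bool).
Proof.
by exists (fun p => (p.1, p.2 (+) S p.1)) (fun p => (p.1, p.2 (+) S p.1)) => -[h b] /=;
  rewrite addbK.
Defined.

(* Toggling a bit over the subgroup generated by [X] commutes with right
   translations by [X], hence, by uniqueness, with all right translations. *)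
Lemma basis_generates g : exists2 w, word_over w & word_val w = g.
Proof.
pose S h := `[< exists2 w, word_over w & word_val w = h >].
suff : S g by move=> /asboolP.
pose t := toggle_bij S.
have regM : {morph regular_bij : x y / x * y}.
  by move=> x y; apply: bij_eq => -[h b]; rewrite /= mulgA.
pose conj x := t^-1 * (regular_bij x * t).
have conjM : {morph conj : x y / x * y}.
  by move=> x y; rewrite /conj regM !mulgA mulgK.
have /(congr1 (fun f => f g)) : regular_bij = conj.
  apply: basis_unique => // x xX.
  suff e : t * regular_bij x = regular_bij x * t by rewrite /conj -e mulKg.
  apply: bij_eq => -[h b] /=; congr (_, _ (+) _).
  apply/asboolP/asboolP => -[w ow ew].
    exists (w ++ [:: (x, true)]); first by rewrite word_over_cat ow /= xX.
    by rewrite word_val_cat ew /word_val big_seq1.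
  exists (w ++ [:: (x, false)]); first by rewrite word_over_cat ow /= xX.
  by rewrite word_val_cat ew /word_val big_seq1 /letter_val /= mulgK.
(* Toggling and then translating by [g] sends [(1, false)] to [(g, true)]; in the other order the
   result is [(g, S g)]. *)
move=> /(congr1 (fun f : bijection _ => (t * f) (1, false))) /=.
have S1 : S 1 by apply/asboolP; exists [::] => //; apply: word_val_nil.
by rewrite S1 mul1g => -[].
Qed.

End FreeGroups.

Section Subgroups.
Variable F : groupType.
Implicit Types (x y : F) (H K M : set F).

Lemma is_subgroupP H :
  is_subgroup H <-> H 1 /\ (forall x y, H x -> H y -> H (x * y^-1)).
Proof.
split=> -[H1 HD]; split.
- by rewrite inE in H1.
- by move=> x y /mem_set Hx /mem_set Hy; apply: set_mem; apply: HD.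
- exact: mem_set.
- by move=> x y /set_mem Hx /set_mem Hy; apply: mem_set; apply: HD.
Qed.

Lemma subgroup1 H : is_subgroup H -> H 1.
Proof. by move/is_subgroupP => []. Qed.

Lemma subgroupV H x : is_subgroup H -> H x -> H x^-1.
Proof. by move/is_subgroupP => [H1 HD] /(HD _ _ H1); rewrite mul1g. Qed.

Lemma subgroupM H x y : is_subgroup H -> H x -> H y -> H (x * y).
Proof.
by move=> sH Hx /(subgroupV sH); move/is_subgroupP: sH => [_ HD] /(HD _ _ Hx); rewrite invgK.
Qed.

Lemma subgroupX H x n : is_subgroup H -> H x -> H (x ^+ n).
Proof.
move=> sH Hx; elim: n => [|n IH]; first exact: subgroup1.
by rewrite expgS; apply: subgroupM.
Qed.

Lemma subgroupJ H x y : is_subgroup H -> H x -> H y -> H (x ^ y).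
Proof.
by move=> sH Hx Hy; rewrite conjgE; apply: subgroupM (subgroupM _ _ _) => //; apply: subgroupV.
Qed.

End Subgroups.

(** * Normal forms and residual finiteness *)

Section NormalForms.
Variables (F : groupType) (X : set F).
Hypothesis basisX : is_basis X.
Implicit Types (g h x : F) (l : F * bool) (u v w : seq (F * bool)).

(* The graph that is a segment labelled by [w] is a partial permutation
   representation; any completion of it moves the first vertex to the last. *)
Lemma reduced_separated w : word_over X w -> reduced w -> w <> [::] ->
  exists m (phi : F -> {perm 'I_m}),
    {morph phi : x y / x * y} /\ phi (word_val w) <> 1.
Proof.
move=> ow rw w0; pose m := size w; exists m.+1.
pose L i := nth (1, true) w i.
have red i : i.+1 < m -> L i.+1 != linv (L i).
  by move=> im; have /(sortedP (1, true)) := rw; apply.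
(* On the segment with vertices from 0 to [m], [fwd x j] asks the generator [x] to move [j] to
   [j.+1], and [bwd x j] asks it to move [j] to [j.-1]. *)
pose fwd x j := (j < m) && (L j == (x, true)).
pose bwd x j := (0 < j) && (L j.-1 == (x, false)).
pose A x := [set j : 'I_m.+1 | fwd x j || bwd x j]%SET.
pose f x (j : 'I_m.+1) : 'I_m.+1 := inord (if fwd x j then j.+1 else j.-1).
have bwd_le x j : bwd x j -> 0 < j by case/andP.
have no_turn x i : i.+1 < m -> fwd x i -> L i.+1 != (x, false).
  by move=> im /andP[_ /eqP e]; have := red _ im; rewrite e.
have injf x : {in A x &, injective (f x)}.
  move=> i j; rewrite !inE => Ai Aj /(congr1 val).
  have [hi hj] := (ltn_ord i, ltn_ord j).
  have lt_fwd (k : 'I_m.+1) : fwd x k -> k < m by case/andP.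
  rewrite /f /= !inordK; first last.
  - by case: ifP => [/lt_fwd|]; lia.
  - by case: ifP => [/lt_fwd|]; lia.
  move: Ai Aj; case: ifP => Fi; case: ifP => Fj //= Bi Bj e.
  - by apply/val_inj; case: e.
  (* Both vertices go to their common neighbour [i.+1], so letters [i] and [i.+1] of [w] would
     cancel. *)
  - have lt : i.+1 < m by lia.
    by have /negP[] := no_turn _ _ lt Fi; move: Bj; rewrite /bwd -e => /andP[].
  - have lt : j.+1 < m by lia.
    by have /negP[] := no_turn _ _ lt Fj; move: Bi; rewrite /bwd e => /andP[].
  - by apply/val_inj => /=; move: (bwd_le _ _ Bi) (bwd_le _ _ Bj); lia.
have [s sE] := choice (fun x => extend_to_perm (@injf x)).
have [phi [phiM phiX]] := basis_extend basisX s.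
exists phi; split => //.
have step i : i < m -> phi (letter_val (L i)) (inord i) = inord i.+1.
  move=> im; have xX : (L i).1 \in X by have /(all_nthP (1, true)) := ow; apply.
  case eL : (L i) xX => [x []] /= xX; rewrite /letter_val /=.
    have Fi : fwd x i by rewrite /fwd im eL eqxx.
    have iE : (inord i : 'I_m.+1) = i :> nat by rewrite inordK // ltnW.
    by rewrite phiX // sE ?inE /f iE Fi.
  have iE : (inord i.+1 : 'I_m.+1) = i.+1 :> nat by rewrite inordK.
  have Bi : bwd x i.+1 by rewrite /bwd /= eL.
  have Fi : fwd x i.+1 = false.
    apply/negP => /andP[im' /eqP eL']; have := red _ im'.
    by rewrite eL eL' /linv /= eqxx.
  rewrite morphV // phiX //; apply: (canLR (permK _)).
  by rewrite sE ?inE /f iE Fi ?Bi.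
have walk i : i <= m -> phi (word_val (take i w)) ord0 = inord i.
  elim: i => [|i IH] im.
    by rewrite take0 word_val_nil morph1 // perm1; apply/val_inj; rewrite /= inordK.
  rewrite (take_nth (1, true)) // -cats1 word_val_cat phiM permM IH 1?ltnW //.
  by rewrite /word_val big_seq1 step.
move=> e; have := walk m (leqnn _); rewrite take_size e perm1 => /(congr1 val).
by rewrite /= inordK // => /esym /size0nil.
Qed.

Lemma reduced_val1 w :
  word_over X w -> reduced w -> word_val w = 1 -> w = [::].
Proof.
move=> ow rw e; apply: contrapT => w0.
have [m [phi [phiM]]] := reduced_separated ow rw w0.
by rewrite e morph1.
Qed.

(** Common first letters are stripped. If the first letters differ, [winv u ++ v] is reduced with
    value 1, so it would be empty. *)
Lemma reduced_inj u v : word_over X u -> word_over X v -> reduced u -> reduced v ->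
  word_val u = word_val v -> u = v.
Proof.
elim: u v => [|a u IH] [|b v] //.
- by rewrite word_val_nil => _ ov _ rv /esym e; apply/esym; apply: reduced_val1 e.
- by rewrite word_val_nil => ou _ ru _; apply: reduced_val1.
move=> ou ov ru rv; rewrite !word_val_cons.
have [->|ab] := eqVneq a b.
  move/mulgI => e; congr cons; apply: IH e.
  - by case/andP: ou.
  - by case/andP: ov.
  - by move: ru; rewrite -cat1s => /reduced_catr.
  - by move: rv; rewrite -cat1s => /reduced_catr.
rewrite -!word_val_cons => e.
suff: winv (a :: u) ++ b :: v = [::] by move/(congr1 size); rewrite size_cat /= addnS.
have red : reduced (winv (a :: u) ++ b :: v).
  have eW : winv (a :: u) = rcons (winv u) (linv a).
    by rewrite -cat1s winv_cat cats1.
  rewrite eW reduced_rcons_cons rv -eW reduced_winv ru.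
  by rewrite /noncancelling linvK eq_sym ab.
apply: reduced_val1 red _; first by rewrite word_over_cat word_over_winv ou ov.
by rewrite word_val_cat word_val_winv e mulVg.
Qed.

Lemma shorter_word w : ~~ reduced w ->
  exists w', [/\ size w' < size w, word_val w' = word_val w & word_over X w -> word_over X w'].
Proof.
move=> /cancelling_split[u [v [a ->]]]; exists (u ++ v); split.
- by rewrite !size_cat /=; lia.
- by rewrite !word_val_cat !word_val_cons letter_valV mulVKg.
- by rewrite !word_over_cat /= => /andP[-> /and3P[]].
Qed.

(** Cancellation shortens [v] until it becomes [u]. Two words with the same value and length
    therefore agree as soon as one of them is reduced. *)
Lemma reduced_shortest u v : word_over X u -> word_over X v -> reduced u ->
  word_val u = word_val v -> u = v \/ size u < size v.
Proof.
have [n] := ubnP (size v); elim: n v => [//|n IH] v hn ou ov ru e.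
have [rv|/shorter_word[v' [lt e' ov']]] := boolP (reduced v).
  by left; apply: reduced_inj.
right; have [||->//|] := IH v' _ ou (ov' ov) ru; [lia|by rewrite e e'|].
by move/ltn_trans; apply.
Qed.

Lemma reduced_word g : exists w, [/\ word_over X w, reduced w & word_val w = g].
Proof.
have [w] := basis_generates basisX g.
have [n] := ubnP (size w); elim: n w => [//|n IH] w hn ow ew.
have [rw|/shorter_word[w' [lt e' ow']]] := boolP (reduced w); first by exists w.
by apply: (IH w'); [lia|exact: ow'|rewrite e'].
Qed.

(** [Q] is a product of finite symmetric groups, one for each nontrivial element of [D]. Its
    finiteness is recorded only as an exponent [n]. *)
Lemma residually_finite (D : seq F) :
  exists (Q : groupType) (q : F -> Q) (n : nat),
    [/\ {morph q : x y / x * y}, 0 < n, forall g, q g ^+ n = 1 &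
        {in D, forall d, q d = 1 -> d = 1}].
Proof.
elim: D => [|d D [Q [q [n [qM n0 qn qD]]]]].
  by exists {perm 'I_1}, (fun=> 1), 1%N; split => // x y; rewrite mulg1.
have [->|d1] := eqVneq d 1.
  by exists Q, q, n; split => // x; rewrite inE => /orP[/eqP->|/qD].
have [w [ow rw ew]] := reduced_word d.
have [|m [phi [phiM phiw]]] := reduced_separated ow rw.
  by move=> w0; move: d1; rewrite -ew w0 word_val_nil eqxx.
exists (Q * {perm 'I_m})%type, (fun g => (q g, phi g)), (n * #|{perm 'I_m}|)%N; split.
- by move=> x y; rewrite qM phiM.
- rewrite muln_gt0 n0; apply/card_gt0P; by exists 1.
- move=> g; have -> k : (q g, phi g) ^+ k = (q g ^+ k, phi g ^+ k).
    by elim: k => // k IH; rewrite !expgS IH.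
  rewrite expgnA qn expg1n mulnC expgnA -cardsT expg_cardG ?inE // expg1n //.
- move=> x; rewrite inE => /orP[/eqP->|xD] [] //; last by move=> /qD h _; apply: h.
  by rewrite -ew.
Qed.

End NormalForms.

(** * Centralizers *)

Section PrimitiveWords.
Variables (F : groupType) (X : set F).
Hypothesis basisX : is_basis X.
Implicit Types (g h x z : F) (l : F * bool) (u v w : seq (F * bool)).

(* For cyclically reduced [r], the last clause says that [r] is not a proper power. *)
Definition primitive_word r :=
  [/\ r <> [::], word_over X r, reduced (r ++ r) &
      forall n, 0 < n < size r -> drop n r ++ take n r <> r].

(** Among all words with a positive power conjugate to [g], a shortest one is taken; any failure of
    primitivity would yield a shorter one. *)
Lemma primitive_root g : g <> 1 ->
  exists r k c, primitive_word r /\ g = (word_val r ^+ k.+1) ^ c.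
Proof.
move=> g1.
pose root r := exists k c, g = (word_val r ^+ k.+1) ^ c.
pose P n := `[< exists r, [/\ word_over X r, size r = n & root r] >].
have exP : exists n, P n.
  have [w ow ew] := basis_generates basisX g.
  by exists (size w); apply/asboolP; exists w; split => //; exists 0%N, 1; rewrite conjg1.
case: (ex_minnP exP) => _ /asboolP[r [or <- [k [c eg]]]] min.
have {}min r' : word_over X r' -> root r' -> size r <= size r'.
  by move=> o h; apply: min; apply/asboolP; exists r'.
have r0 : r <> [::] by move=> r0; apply: g1; rewrite eg r0 word_val_nil expg1n conj1g.
have red : reduced r.
  apply: contrapT => /negP/(shorter_word X)[r' [lt e o]].
  suff /(min _ (o or)) : root r' by rewrite leqNgt lt.
  by exists k, c; rewrite e.
exists r, k, c; split=> //; split => //.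
  have [b [s er]] : exists b s, r = b :: s by case: (r) r0 => // b s; exists b, s.
  have [u [l er']] : exists u l, r = rcons u l.
    by case/lastP: (r) r0 => // u l; exists u, l.
  rewrite {1}er' {1}er reduced_rcons_cons -er' -er red andbT /=.
  (* If the first and last letters of [r] cancel, conjugating by the last one leaves the inner word
     [u]. *)
  apply/eqP => eb; case: u er' => [|b' u].
    by rewrite er => -[] bl; move: (linv_neq l); rewrite -eb bl eqxx.
  rewrite er => -[? es]; subst b'; subst s b.
  have o : word_over X u.
    by move: or; rewrite er -cats1 -cat_cons word_over_cat => /andP[] /andP[].
  suff /(min _ o) : root u by rewrite er /= size_rcons; lia.
  exists k, (letter_val l * c).
  rewrite eg er word_val_cons letter_valV -cats1 word_val_cat /word_val big_seq1.
  by rewrite conjgM; congr (_ ^ _); rewrite conjXg.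
(* A rotation fixing [r] makes its two pieces commute, so [r] is a proper power of a shorter word
   [t]. *)
move=> n /andP[n0 nr]; rewrite -{3}(cat_take_drop n r) => /commuting_words[t [i [j]]] [ei ej].
have er : r = wpow t (j + i) by rewrite wpowD -ei -ej cat_take_drop.
have sr : size r = ((j + i) * size t)%N by rewrite er size_wpow.
have sn : n = (j * size t)%N by rewrite -size_wpow -ej size_takel // ltnW.
have o : word_over X t.
  by move: or; rewrite er; case: (j + i)%N sr => [|q] sr; [lia|rewrite word_over_cat => /andP[]].
have [j0 t0] : 0 < j /\ 0 < size t by apply/andP; rewrite -muln_gt0 -sn.
have i0 : 0 < i by rewrite lt0n; apply/eqP => i0; move: nr; rewrite sn sr i0 addn0 ltnn.
have : root t.
  exists ((j + i) * k.+1).-1, c.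
  by rewrite eg er word_val_wpow -expgnA prednK // muln_gt0 addn_gt0 j0.
move/(min _ o); apply/negP; rewrite -ltnNge sr.
by rewrite ltn_Pmull //; lia.
Qed.

Section Centralizers.
Variable r : seq (F * bool).
Hypothesis primr : primitive_word r.

Let m := size r.
Let rho := word_val r.
Let prefix n := word_val (take n r).

Let r_neq0 : r <> [::]. Proof. by case: primr. Qed.
Let overr : word_over X r. Proof. by case: primr. Qed.
Let redrr : reduced (r ++ r). Proof. by case: primr. Qed.
Let redr : reduced r. Proof. exact: reduced_catl redrr. Qed.
Let m_gt0 : 0 < m. Proof. by rewrite lt0n size_eq0; apply/eqP. Qed.

(** The words [w ++ r] and [r ++ w] have the same value and length, so they coincide once one of
    them is reduced. *)
Let commuting_word z w : word_over X w -> reduced w -> word_val w = z ->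
  commute z rho -> reduced (w ++ r) || reduced (r ++ w) ->
  exists j, z = rho ^+ j.
Proof.
move=> ow rw ew zr red.
have o : word_over X (w ++ r) && word_over X (r ++ w).
  by rewrite !word_over_cat ow overr.
have ez : word_val (w ++ r) = word_val (r ++ w) by rewrite !word_val_cat ew.
have sz : size (w ++ r) = size (r ++ w) by rewrite !size_cat addnC.
have e : w ++ r = r ++ w.
  case/andP: o => o1 o2; case/orP: red => red.
    by have [] := reduced_shortest basisX o1 o2 red ez; rewrite // sz ltnn.
  by have [] := reduced_shortest basisX o2 o1 red (esym ez); rewrite // sz ltnn.
have [|j ewj] := primitive_commute _ r_neq0 e; first by case: primr.
by exists j; rewrite -ew ewj word_val_wpow.
Qed.

(** If [w ++ r] is not reduced, the first letters of [winv w] and of [r] agree. Then [r ++ winv w]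
    is reduced because [r ++ r] is, and the argument applies to [z^-1]. *)
Lemma primitive_centralizer z :
  commute z rho -> exists j, z = rho ^+ j \/ z = rho ^- j.
Proof.
move=> zr; have [w [ow rw ew]] := reduced_word basisX z.
have [red|nred] := boolP (reduced (w ++ r)).
  by have [|j ->] := commuting_word ow rw ew zr; rewrite ?red //; exists j; left.
suff red : reduced (r ++ winv w).
  have [|||||j e] := @commuting_word z^-1 (winv w).
  - by rewrite word_over_winv.
  - by rewrite reduced_winv.
  - by rewrite word_val_winv ew.
  - exact/commute_sym/commuteV/commute_sym.
  - by rewrite red orbT.
  by exists j; right; rewrite -e invgK.
have [b [s er]] : exists b s, r = b :: s by case: (r) r_neq0 => // b s; exists b, s.
have [u [l er']] : exists u l, r = rcons u l.
  by case/lastP: (r) r_neq0 => // u l; exists u, l.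
have lb : noncancelling l b.
  by move: redrr; rewrite {1}er' {1}er reduced_rcons_cons => /and3P[].
case/lastP: w ow rw ew nred => [|w a] ow rw ew.
  by rewrite redr.
rewrite {1}er reduced_rcons_cons rw -er redr andbT negbK => /eqP ba.
have eW : winv (rcons w a) = linv a :: winv w by rewrite -cats1 winv_cat.
rewrite eW er' reduced_rcons_cons -er' redr -eW reduced_winv rw andbT /=.
by rewrite -ba.
Qed.

(** The stretch of the periodic word [r r r ...] from position [a] to position [j * m + b] is
    reduced, hence equals [s]. Its length [m] forces [j = 1] and [a = b]. *)
Let segment a b j s : a < m -> b < m -> a <= j * m + b ->
    word_over X s -> reduced s -> size s = m ->
    word_val s = (prefix a)^-1 * (rho ^+ j * prefix b) ->
  a = b /\ s = drop a r ++ take a r.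
Proof.
move=> am bm ab os rs sm es.
pose R := take (j * m + b) (wpow r j.+1); pose s' := drop a R.
have eR : R = wpow r j ++ take b r.
  rewrite /R wpowSr take_cat size_wpow -/m ltnNge leq_addr /=.
  by rewrite addnC addnK.
have redR : reduced R by apply/reduced_take/reduced_wpow.
have sR : size R = (j * m + b)%N.
  by rewrite eR size_cat size_wpow size_takel // ltnW.
have oR : word_over X R.
  have oT n : word_over X (take n r).
    by move: overr; rewrite -{1}(cat_take_drop n r) word_over_cat => /andP[].
  by rewrite eR word_over_cat oT andbT; elim: (j) => [|i IH] //; rewrite wpowS word_over_cat overr.
have takeR : take a R = take a r.
  rewrite eR; case: (j) ab => [|i] ab /=; first by rewrite take_takel //; lia.
  by rewrite wpowS -catA takel_cat // ltnW.
have es' : word_val s' = word_val s.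
  rewrite es; apply: (mulgI (prefix a)); rewrite mulVKg /prefix -takeR -word_val_cat.
  by rewrite cat_take_drop eR word_val_cat word_val_wpow.
have ess : s = s'.
  apply: (reduced_inj basisX) => //; last exact: reduced_drop.
  by move: oR; rewrite -{1}(cat_take_drop a R) word_over_cat => /andP[].
have : size s' = m by rewrite -ess.
rewrite size_drop sR => eqm.
have [ej eab] : j = 1%N /\ a = b by case: (j) eqm => [|[|i]]; nia.
by split=> //; rewrite ess /s' eR ej -eab /wpow /= cats0 drop_cat am.
Qed.

(** The element is a power of [rho], which makes [rho] or [rho^-1] the value of a stretch of the
    periodic word. The first case gives a rotation fixing [r]; in the second, [winv r] would be a
    rotation of [r]. *)
Lemma primitive_double_coset a b : a < m -> b < m ->
  commute (prefix a * rho * (prefix b)^-1) rho -> a = 0 /\ b = 0.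
Proof.
move=> am bm.
have no_inv a' b' j : a' < m -> b' < m -> a' <= j * m + b' ->
    rho^-1 <> (prefix a')^-1 * (rho ^+ j * prefix b').
  move=> am' bm' le; rewrite -word_val_winv => e.
  have [|||_] := segment am' bm' le _ _ _ e.
  - by rewrite word_over_winv.
  - by rewrite reduced_winv.
  - by rewrite size_winv.
  - exact: winv_rot_neq.
have pos j : prefix a * rho * (prefix b)^-1 = rho ^+ j -> a = 0 /\ b = 0.
  move=> e; have er : rho = (prefix a)^-1 * (rho ^+ j * prefix b).
    by rewrite -e mulgVK mulKg.
  have [le|lt] := leqP a (j * m + b).
    have [eab err] := segment am bm le overr redr erefl er.
    case: primr => _ _ _ prim; have [a0|a0] := posnP a; first by rewrite -eab a0.
    by case: (prim a); rewrite ?a0.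
  (* Here [b < a], and inverting the equation shows that [rho^-1] is the value of a stretch from [b]
     to [a]. *)
  have j0 : j = 0 by case: (j) lt => // i; rewrite mulSn; lia.
  case: (@no_inv b a 0); [done|done|lia|].
  by rewrite er j0 invgM invgK !mul1g.
move/primitive_centralizer => [j [/pos//|e]].
have [le|lt] := leqP b (j * m + a).
  case: (no_inv b a j) => //.
  have -> : rho ^+ j = prefix b * rho^-1 * (prefix a)^-1.
    by rewrite -[LHS]invgK -e !invgM invgK mulgA.
  by rewrite mulgVK mulKg.
have j0 : j = 0 by case: (j) lt => // i; rewrite mulSn; lia.
by apply: (pos 0); rewrite e j0 invg1.
Qed.

Lemma primitive_prefix a : a < m -> commute (prefix a) rho -> a = 0.
Proof.
move=> am ca; have [] // : a = 0 /\ a = 0.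
by apply: primitive_double_coset => //; rewrite ca mulgK.
Qed.

End Centralizers.

End PrimitiveWords.

(** * Holonomy *)

Section Cocycles.
Variables (F : groupType) (X : set F) (T : Type).
Hypothesis basisX : is_basis X.
Implicit Types (f g h k x : F) (l : F * bool) (u v w : seq (F * bool)).

Lemma basis_ind (P : F -> Prop) :
    P 1 -> (forall l g, l.1 \in X -> P g -> P (letter_val l * g)) ->
  forall g, P g.
Proof.
move=> P1 PX g; have [w ow <-] := basis_generates basisX g.
elim: w ow => [|l w IH] /=; first by rewrite word_val_nil.
by move=> /andP[lX ow]; rewrite word_val_cons; apply: PX (IH ow).
Qed.

(* [lab g l] is the label of the edge that leaves [g] in the Cayley graph of [F]
   along the letter [l]; [lam g f] is the holonomy of the path from [g] to
   [g * f]. *)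
Variable lab : F -> F * bool -> T -> T.

Definition is_holonomy (lam : F -> F -> T -> T) :=
  [/\ forall g i, lam g 1 i = i,
      forall g f f' i, lam g (f * f') i = lam (g * f) f' (lam g f i) &
      forall g l, l.1 \in X -> lam g (letter_val l) =1 lab g l].

(** Each letter permutes [F * T], moving along its edge and applying the label. The universal
    property extends this to an action of [F], whose second component is the holonomy. *)
Lemma holonomy_exists :
    (forall g l, involutive (lab g l)) ->
    (forall g l, lab (g * letter_val l) (linv l) = lab g l) ->
  exists lam, is_holonomy lam.
Proof.
move=> labK labV.
pose step l (p : F * T) := (p.1 * letter_val l, lab p.1 l p.2).
have stepK l : cancel (step l) (step (linv l)).
  by move=> [g i]; rewrite /step /= letter_valV mulgK labV labK.
have stepVK l : cancel (step (linv l)) (step l).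
  by move=> p; have := stepK (linv l) p; rewrite linvK.
pose bij x := Bijection (stepK (x, true)) (stepVK (x, true)).
have [psi [psiM psiX]] := basis_extend basisX bij.
have psi_step l p : l.1 \in X -> psi (letter_val l) p = step l p.
  case: l => x [] xX; rewrite /letter_val /=; first by rewrite psiX.
  by rewrite morphV // psiX.
have psi1 p : psi 1 p = p by rewrite morph1.
have psi_fst f : forall p, (psi f p).1 = p.1 * f.
  elim/basis_ind: f => [p|l f lX IH p]; first by rewrite psi1 mulg1.
  by rewrite psiM /= IH psi_step // mulgA.
exists (fun g f i => (psi f (g, i)).2); split => [g i|g f f' i|g l lX i].
- by rewrite psi1.
- by rewrite psiM /= {1}[psi f (g, i)]surjective_pairing psi_fst.
- by rewrite psi_step.
Qed.

Variable lam : F -> F -> T -> T.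
Hypothesis lamP : is_holonomy lam.

Let lam1 g i : lam g 1 i = i. Proof. by case: lamP. Qed.
Let lamM g f f' i : lam g (f * f') i = lam (g * f) f' (lam g f i).
Proof. by case: lamP. Qed.
Let lamX g l : l.1 \in X -> lam g (letter_val l) =1 lab g l.
Proof. by case: lamP => _ _; apply. Qed.

Lemma holonomyK g f : cancel (lam g f) (lam (g * f) f^-1).
Proof. by move=> i; rewrite -lamM mulgV lam1. Qed.

Lemma holonomy_invariant k : (forall g l, lab (k * g) l = lab g l) ->
  forall g f, lam (k * g) f =1 lam g f.
Proof.
move=> labk g f; elim/basis_ind: f g => [|l f lX IH] g i; first by rewrite !lam1.
by rewrite !lamM !lamX // labk -mulgA IH.
Qed.

(** Both sides follow one path from [h * c^-1], because [c * f ^ c = f * c]. *)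
Lemma holonomy_conj h f c j :
  lam h (f ^ c) (lam (h * c^-1) c j) = lam (h * c^-1 * f) c (lam (h * c^-1) f j).
Proof. by rewrite -{1}(mulgVK c h) -!lamM -conjgC. Qed.

Lemma holonomy_path (S : (T -> T) -> Prop) g w :
    S id -> (forall s s', S s -> S s' -> S (s' \o s)) -> word_over X w ->
    (forall u l v, w = u ++ l :: v -> S (lab (g * word_val u) l)) ->
  S (lam g (word_val w)).
Proof.
move=> S1 SM; elim/last_ind: w => [|w l IH] ow Sw.
  by rewrite word_val_nil (_ : lam g 1 = id) //; apply/funext => i; rewrite lam1.
move: ow; rewrite -cats1 word_over_cat /= andbT => /andP[ow lX].
rewrite word_val_cat /word_val big_seq1.
rewrite (_ : lam _ _ = lab (g * word_val w) l \o lam g (word_val w)).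
  apply: SM; last by apply: (Sw _ _ [::]); rewrite cats1.
  by apply: IH => // u l' v e; apply: (Sw _ _ (rcons v l)); rewrite e rcons_cat.
by apply/funext => i; rewrite lamM lamX.
Qed.

End Cocycles.

(** [i] counts the full periods before the letter [x], and [a] is its position within a period. *)
Lemma wpow_split (A : eqType) (r u v : seq A) x n : u ++ x :: v = wpow r n ->
  exists i a, [/\ a < size r, u = wpow r i ++ take a r & take a.+1 r = rcons (take a r) x].
Proof.
elim: n u => [|n IH] u; first by case: u.
have [lt|le] := ltnP (size u) (size r).
  rewrite wpowS => e; exists 0, (size u).
  have eu : take (size u) r = u.
    by have /(congr1 (take (size u))) := e; rewrite take_size_cat // takel_cat // ltnW.
  split=> //; rewrite eu.
  have /(congr1 (take (size u).+1)) := e; rewrite [RHS]takel_cat // => <-.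
  by rewrite -cat_rcons take_size_cat ?size_rcons.
rewrite wpowS => e.
have eu : u = r ++ drop (size r) u.
  have /(congr1 (take (size r))) := e; rewrite takel_cat // take_size_cat // => {1}<-.
  by rewrite cat_take_drop.
move: e; rewrite eu -catA => /eqP; rewrite eqseq_cat // eqxx => /eqP /IH.
by move=> [i [a [am -> ?]]]; exists i.+1, a; split => //; rewrite wpowS catA.
Qed.

(** * The separating normal subgroup *)

(** With [flop], a generator of the infinite dihedral group: [flip] followed by [flop] is the
    translation by 1. *)
Definition flip (i : int) : int := (- i)%R.
Definition flop (i : int) : int := (1 - i)%R.

Lemma flipK : involutive flip.
Proof. by move=> i; rewrite /flip; lia. Qed.

Lemma flopK : involutive flop.
Proof. by move=> i; rewrite /flop; lia. Qed.

Section Separation.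
Variables (F : groupType) (X H : set F) (r : seq (F * bool)) (c d : F).
Hypotheses (basisX : is_basis X) (subH : is_subgroup H).
Hypothesis primr : primitive_word X r.

Let m := size r.
Let rho := word_val r.
Let prefix a := word_val (take a r).

Hypothesis cosets_neq : forall h i, H h -> d^-1 <> h * (c^-1 * rho ^+ i).

Variables (Q : groupType) (q : F -> Q).
Hypothesis qM : {morph q : x y / x * y}.
(** This and the next two hypotheses carry [primitive_prefix] and [primitive_double_coset] over to
    [Q]; they hold once finitely many elements survive there. *)
Hypothesis q_rho : q rho <> 1.
Hypothesis q_prefix : forall a, a < m -> commute (q (prefix a)) (q rho) -> a = 0.
Hypothesis q_double : forall a b, a < m -> b < m ->
  commute (q (prefix a) * q rho * (q (prefix b))^-1) (q rho) -> a = 0 /\ b = 0.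

Let q1 : q 1 = 1. Proof. exact: morph1. Qed.
Let qV : {morph q : x / x^-1}. Proof. exact: morphV. Qed.
Let qX n : {morph q : x / x ^+ n}. Proof. exact: morphX. Qed.

Let r_neq0 : r <> [::]. Proof. by case: primr. Qed.
Let overr : word_over X r. Proof. by case: primr. Qed.
Let redrr : reduced (r ++ r). Proof. by case: primr. Qed.
Let m_gt0 : 0 < m. Proof. by rewrite lt0n size_eq0; apply/eqP. Qed.
Let prefix0 : prefix 0 = 1. Proof. by rewrite /prefix take0 word_val_nil. Qed.
Let prefixm : prefix m = rho. Proof. by rewrite /prefix take_size. Qed.

(* The group [K] of the introduction. *)
Definition deck : set F := [set g | H g /\ q g = 1].

Lemma deckP : is_subgroup deck.
Proof.
apply/is_subgroupP; split; first by split; [apply: subgroup1|].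
move=> x y [Hx qx] [Hy qy]; split; last by rewrite qM qV qx qy mulgV.
by apply: subgroupM => //; apply: subgroupV.
Qed.

Lemma deckJ g h : deck g -> H h -> deck (g ^ h).
Proof.
move=> [Hg qg] Hh; split; first exact: subgroupJ.
by rewrite conjgE !qM qg mul1g -qM mulVg.
Qed.

(* A vertex [K g] of [K \ F] is represented by any of its elements [g]; these
   are the vertices [K d^-1] and [K d^-1 rho]. *)
Definition at_start g := `[< deck (g * d) >].
Definition at_end g := at_start (g * rho^-1).

Lemma at_start_deck k g : deck k -> at_start (k * g) = at_start g.
Proof.
move=> Kk; apply/asboolP/asboolP; rewrite -mulgA; last exact: subgroupM deckP Kk.
by move/(subgroupM deckP (subgroupV deckP Kk)); rewrite mulKg.
Qed.

Lemma at_end_deck k g : deck k -> at_end (k * g) = at_end g.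
Proof. by rewrite /at_end -mulgA; apply: at_start_deck. Qed.

Let first_letter := head (1, true) r.

Let r_cons : r = first_letter :: behead r.
Proof. by rewrite /first_letter; case: (r) r_neq0. Qed.

(* Both labels are involutions, so an edge need not record in which direction it
   is traversed. *)
Definition crosses (P : F -> bool) g l :=
  P g && (l == first_letter) || P (g * letter_val l) && (linv l == first_letter).

Lemma crossesV P g l : crosses P (g * letter_val l) (linv l) = crosses P g l.
Proof. by rewrite /crosses letter_valV mulgK linvK orbC. Qed.

Definition label g l : int -> int :=
  if crosses at_start g l then flip else if crosses at_end g l then flop else id.

Lemma labelK g l : involutive (label g l).
Proof.
by rewrite /label; case: ifP => _; [exact: flipK|case: ifP => _; [exact: flopK|]].
Qed.

Lemma labelV g l : label (g * letter_val l) (linv l) = label g l.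
Proof. by rewrite /label !crossesV. Qed.

Lemma label_deck k g l : deck k -> label (k * g) l = label g l.
Proof.
move=> Kk; have crossesD P : (forall x, P (k * x) = P x) ->
    crosses P (k * g) l = crosses P g l.
  by move=> Pk; rewrite /crosses -mulgA !Pk.
rewrite /label !crossesD // => x; [exact: at_end_deck|exact: at_start_deck].
Qed.

Variable lam : F -> F -> int -> int.
Hypothesis lamP : is_holonomy X label lam.

Let lam1 g i : lam g 1 i = i. Proof. by case: lamP. Qed.
Let lamM g f f' i : lam g (f * f') i = lam (g * f) f' (lam g f i).
Proof. by case: lamP. Qed.

Lemma lam_deck k g f : deck k -> lam (k * g) f =1 lam g f.
Proof. by move=> Kk; apply: (holonomy_invariant basisX lamP) => *; apply: label_deck. Qed.

(** * Paths along powers of [rho] *)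

Definition visits (P : F -> bool) g :=
  exists i a, a < m /\ P (g * (rho ^+ i * prefix a)).

Lemma crosses_visits P g u l v n :
  u ++ l :: v = wpow r n -> crosses P (g * word_val u) l -> visits P g.
Proof.
move=> /wpow_split[i [a [am -> tS]]].
have ea : letter_val l = (prefix a)^-1 * prefix a.+1.
  by rewrite /prefix tS -cats1 word_val_cat mulKg /word_val big_seq1.
rewrite /crosses word_val_cat word_val_wpow -/rho -/(prefix a) ea -!mulgA mulVKg.
case/orP => /andP[Pg _]; first by exists i, a.
have [lt|ge] := ltnP a.+1 m; first by exists i, a.+1.
(* The endpoint of the last letter of a period is the start of the next period. *)
exists i.+1, 0; split => //; rewrite prefix0 mulg1 expgSr.
have em : a.+1 = m by apply/eqP; rewrite eqn_leq am.
by move: Pg; rewrite em prefixm.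
Qed.

(** Comparing the two visits in [Q] puts [prefix a * rho * (prefix b)^-1] among the powers of [rho],
    so [a = 0] by [q_double]. The first visit then contradicts [cosets_neq]. *)
Lemma visits_excl h : H h -> visits at_start (h * c^-1) -> ~ visits at_end (h * c^-1).
Proof.
move=> Hh [i [a [am /asboolP[Hs qs]]]] [j [b [bm /asboolP[_ qe]]]].
have e : q (prefix a) * q rho * (q (prefix b))^-1 = (q rho)^-i * q rho ^+ j.
  have es : q rho ^+ i * q (prefix a) = q rho ^+ j * q (prefix b) / q rho.
    move: qs qe; rewrite !(qM, qX, qV) -!mulgA => qs qe.
    apply: (mulgI (q h * (q c)^-1)); apply: (mulIg (q d)).
    by rewrite -!mulgA qs qe.
  rewrite -[q (prefix a)](mulKg (q rho ^+ i)) es.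
  by rewrite -!mulgA mulKg mulgV mulg1.
have [] := q_double am bm.
  rewrite e; apply/commute_sym/commuteM; last exact/commuteX.
  exact/commuteV/commuteX.
move=> a0 _; move: Hs; rewrite a0 prefix0 mulg1 => Hs.
apply: (@cosets_neq ((h * c^-1 * rho ^+ i * d)^-1 * h) i).
  by apply: subgroupM => //; apply: subgroupV.
by rewrite -[RHS]mulgA (mulgA h c^-1) invgM mulgVK.
Qed.

(** By [visits_excl] only one of the two reflections occurs among the labels on the path, so the
    holonomy is that reflection or the identity. *)
Lemma lam_rho_involution h n : H h -> involutive (lam (h * c^-1) (rho ^+ n)).
Proof.
move=> Hh; have overW : word_over X (wpow r n).
  by elim: n => // n IH; rewrite wpowS word_over_cat overr.
have two_valued s : involutive s ->
    (forall u l v, wpow r n = u ++ l :: v ->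
       label (h * c^-1 * word_val u) l = id \/ label (h * c^-1 * word_val u) l = s) ->
  involutive (lam (h * c^-1) (rho ^+ n)).
  move=> sK lab_s; have ss : s \o s = id by apply/funext.
  rewrite -word_val_wpow.
  suff [->|->] : lam (h * c^-1) (word_val (wpow r n)) = id \/
                 lam (h * c^-1) (word_val (wpow r n)) = s by [].
  apply: (holonomy_path (S := fun t => t = id \/ t = s) lamP _ _ overW) ; [by left| |exact: lab_s].
  by move=> t t' [->|->] [->|->]; rewrite ?ss; auto.
have [vs|nvs] := pselect (visits at_start (h * c^-1)).
  apply: (two_valued flip flipK) => u l v /esym e.
  rewrite /label; case: ifP => _; first by right.
  case: ifP => [/(crosses_visits e)/(visits_excl Hh vs)//|_]; by left.
apply: (two_valued flop flopK) => u l v /esym e.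
rewrite /label; case: ifP => [/(crosses_visits e)//|_].
by case: ifP => _; [right|left].
Qed.

Lemma no_interior_visit i a : 0 < a < m ->
  ~~ at_start (d^-1 * rho ^+ i * prefix a) /\ ~~ at_end (d^-1 * rho ^+ i * prefix a).
Proof.
(* [z] is 1 for [at_start] and the inverse of [q rho] for [at_end]. A visit would write
   [q (prefix a)] as a product of elements commuting with [q rho]. *)
case/andP=> a0 am; suff key z : commute (q rho) z ->
    q (d^-1 * rho ^+ i * prefix a) * z * q d <> 1.
  split; apply/negP => /asboolP[_]; rewrite !(qM _ d).
    by rewrite -[q _]mulg1; apply: key; apply: commute1.
  by rewrite (qM _ rho^-1); apply: key; rewrite qV; apply: commuteV.
move=> zc; rewrite !qM qX qV => e; move: a0; rewrite (q_prefix am) //.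
have -> : q (prefix a) = (q rho)^-i * z^-1.
  have e' : q rho ^+ i * q (prefix a) * z = 1.
    by apply: (mulgI (q d)^-1); apply: (mulIg (q d)); rewrite mulg1 mulVg -e !mulgA.
  by apply: (mulgI (q rho ^+ i)); apply: (mulIg z); rewrite mulVKg mulVg e'.
apply/commute_sym/commuteM; first exact/commuteV/commuteX.
exact/commuteV.
Qed.

Lemma lam_rho_step i : lam (d^-1 * rho ^+ i) rho =1
  if at_start (d^-1 * rho ^+ i) then flip
  else if at_end (d^-1 * rho ^+ i) then flop else id.
Proof.
have [fX oX] : first_letter.1 \in X /\ word_over X (behead r).
  by apply/andP; move: overr; rewrite {1}r_cons.
have last_neq l u : r = rcons u l -> (linv l == first_letter) = false.
  move=> er; move: redrr; rewrite {1}er {1}r_cons reduced_rcons_cons => /and3P[_ nc _].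
  by rewrite eq_sym (negbTE nc).
set g := d^-1 * rho ^+ i.
(* Past the first letter of a period every label is trivial. *)
have tail : lam (g * letter_val first_letter) (word_val (behead r)) = id.
  apply: (holonomy_path (S := fun t => t = id) lamP) => // [s s' -> ->//|u l v e].
  pose a := (size u).+1.
  have er : r = (first_letter :: u) ++ l :: v by rewrite {1}r_cons e.
  have am : 0 < a < m by rewrite /a /m er size_cat /= addnS ltnS leq_addr.
  have ea : letter_val first_letter * word_val u = prefix a.
    by rewrite -word_val_cons /prefix er take_size_cat.
  have eaS : letter_val first_letter * (word_val u * letter_val l) = prefix a.+1.
    rewrite /prefix er -cat_rcons take_size_cat ?size_rcons //.
    by rewrite rcons_cons word_val_cons -cats1 word_val_cat /word_val big_seq1.
  have [ns ne] := no_interior_visit i am.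
  (* The endpoint of the last letter may be marked, but that letter is not the inverse of the first
     one since [r ++ r] is reduced. *)
  have last_ok P : (a.+1 < m -> ~~ P (g * prefix a.+1)) ->
      P (g * prefix a.+1) && (linv l == first_letter) = false.
    move=> nP; case: v e er => [|l' v] e er; last first.
      by rewrite (negbTE (nP _)) // /m er size_cat /= !addnS !ltnS leq_addr.
    by rewrite (last_neq l (first_letter :: u)) ?andbF // er cats1.
  rewrite /label /crosses -!(mulgA g) -mulgA eaS ea (negbTE ns) (negbTE ne) /=.
  by rewrite !last_ok // => lt; have [] := no_interior_visit i (lt : 0 < a.+1 < m).
rewrite {1}/rho r_cons word_val_cons => j.
rewrite lamM tail; case: lamP => _ _ -> //.
rewrite /label /crosses eqxx !andbT.
have -> : (linv first_letter == first_letter) = false by apply/negbTE/linv_neq.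
by rewrite !andbF !orbF; case: ifP => // _; case: ifP.
Qed.

Hypothesis finite_order : exists2 n, 0 < n & deck (rho ^+ n ^ d).

(** [n] is the least positive exponent returning to the start vertex. One turn applies [flip], then
    [flop], then only identities, which translates by 1. *)
Lemma lam_start_unbounded : exists2 n, 0 < n &
  deck (rho ^+ n ^ d) /\
  forall p i, lam d^-1 (rho ^+ (n * p)) i = (i + p%:Z)%R.
Proof.
pose P n := (0 < n) && at_start (d^-1 * rho ^+ n).
have PE n : at_start (d^-1 * rho ^+ n) = `[< deck (rho ^+ n ^ d) >].
  by rewrite /at_start conjgE mulgA.
have exP : exists n, P n.
  by case: finite_order => n n0 kn; exists n; rewrite /P n0 PE; apply/asboolP.
case: (ex_minnP exP) => n /andP[n0 an] min.
have kn : deck (rho ^+ n ^ d) by apply/asboolP; rewrite -PE.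
exists n => //; split => //.
have a0 : at_start (d^-1 * rho ^+ 0).
  by rewrite PE; apply/asboolP; rewrite expg0 conj1g; apply: subgroup1 deckP.
(* Since [q rho] is nontrivial, the start and end vertices differ and a turn has at least two
   steps. *)
have na1 : ~~ at_start (d^-1 * rho ^+ 1).
  rewrite PE; apply/asboolP => -[_]; rewrite conjgE !qM qV => e; apply: q_rho.
  by apply: (mulgI (q d)^-1); apply: (mulIg (q d)); rewrite mulg1 mulVg -mulgA.
have n2 : 1 < n.
  by rewrite ltn_neqAle n0 andbT; apply/eqP => n1; move: an; rewrite -n1 (negbTE na1).
have endE k : at_end (d^-1 * rho ^+ k.+1) = at_start (d^-1 * rho ^+ k).
  by rewrite /at_end expgSr mulgA mulgK.
have inner k : 0 < k < n -> at_start (d^-1 * rho ^+ k) = false.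
  by case/andP=> k0 kn'; apply/negP => ak; have := min k; rewrite /P k0 ak leqNgt kn' => /(_ isT).
have walk k : k.+2 <= n -> forall i, lam d^-1 (rho ^+ k.+2) i = (i + 1)%R.
  elim: k => [|k IH] kn' i.
    rewrite expgS expg1 lamM -[X in lam X rho i]mulg1 -(expg0 rho) lam_rho_step a0.
    rewrite -[X in d^-1 * X](expg1 rho) lam_rho_step (negbTE na1) endE a0.
    by rewrite /flip /flop; lia.
  rewrite expgSr lamM IH; last exact: ltnW.
  by rewrite lam_rho_step inner // endE inner //= ltnW.
have turn i : lam d^-1 (rho ^+ n) i = (i + 1)%R.
  by case: (n) n2 walk => [|[|k]] // _; apply.
elim=> [|p IH] i; first by rewrite muln0 lam1 GRing.addr0.
rewrite mulnSr expgnDr lamM IH.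
have -> : d^-1 * rho ^+ (n * p) = (rho ^+ n ^ d) ^+ p * d^-1.
  by rewrite -conjXg -expgnA conjgE !mulgA mulgK.
by rewrite lam_deck ?turn; [lia|apply: subgroupX deckP _].
Qed.

(** Triviality is required at every [h] in [H] because conjugation by elements of [H] moves these
    base points among themselves. *)
Definition separating_normal : set F :=
  [set x | deck x /\ forall h, H h -> lam h x =1 id].

(** The hypothesis says that [x] is a loop at the vertex of [h * t^-1], so the final stretch along
    [t] has the same holonomy before and after the loop. *)
Lemma lam_conj h t x j : deck (x ^ (h * t^-1)^-1) ->
  lam h (x ^ t) (lam (h * t^-1) t j) = lam (h * t^-1) t (lam (h * t^-1) x j).
Proof.
move=> kx; rewrite (holonomy_conj lamP).
have -> : h * t^-1 * x = x ^ (h * t^-1)^-1 * (h * t^-1) by rewrite conjgCV.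
exact: lam_deck.
Qed.

Lemma lam_surj g f i : exists j, i = lam (g * f^-1) f j.
Proof.
exists (lam g f^-1 i); have := holonomyK lamP g f^-1 i.
by rewrite invgK.
Qed.

Lemma separating_normalP : is_normal_subgroup H separating_normal.
Proof.
have lamV g x i : lam (g * x^-1) x i = i -> lam g x^-1 i = i.
  by move=> e; have := holonomyK lamP (g * x^-1) x i; rewrite mulgVK e.
split; first 1 last.
- by move=> x [[]].
- move=> x t [kx lx] Ht; split; first exact: deckJ.
  move=> h Hh i; have [j ->] := lam_surj h t i.
  have Hht : H (h * t^-1) by apply: subgroupM => //; apply: subgroupV.
  by rewrite lam_conj ?lx //; apply: deckJ => //; apply: subgroupV.
apply/is_subgroupP; split; first by split=> [|h _ i]; [apply: subgroup1 deckP|].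
move=> x y [kx lx] [ky ly]; have kyV := subgroupV deckP ky.
split; first exact: subgroupM deckP _ _.
move=> h Hh i; rewrite lamM lx //; apply: lamV.
by apply: ly; apply: subgroupM (subgroupM _ _ _) (proj1 kyV) => //; case: kx.
Qed.

(** The loop [rho ^+ n] at [h * c^-1] has involutive holonomy; running it twice gives the
    identity. *)
Lemma separating_normal_rho n : deck (rho ^+ n ^ c) ->
  separating_normal (rho ^+ (n * 2) ^ c).
Proof.
move=> kn; have kn2 : deck (rho ^+ (n * 2) ^ c).
  by rewrite expgnA conjXg; apply: subgroupX deckP kn.
split=> // h Hh i; have [j ->] := lam_surj h c i.
have kJ k : deck (rho ^+ k ^ c) -> deck (rho ^+ k ^ (h * c^-1)^-1).
  by move=> kk; rewrite invgM invgK conjgM; apply: deckJ (subgroupV _ Hh).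
rewrite lam_conj; last exact: kJ.
rewrite muln2 -addnn expgnDr lamM.
have -> : h * c^-1 * rho ^+ n = rho ^+ n ^ (h * c^-1)^-1 * (h * c^-1).
  by rewrite conjgCV.
by rewrite (lam_deck _ _ (kJ _ kn)) lam_rho_involution.
Qed.

(** With [p] the number of steps in a turn, the [p]-th power makes [n] full turns at [d^-1], hence
    translates by [n]. *)
Lemma separating_normal_rho_conj n : 0 < n -> deck (rho ^+ n ^ d) ->
  ~ separating_normal (rho ^+ n ^ d).
Proof.
move=> n0 kn Nn; have [p p0 [kp lamp]] := lam_start_unbounded.
have [_ /(_ 1 (subgroup1 subH))] : separating_normal (rho ^+ (n * p) ^ d).
  case: separating_normalP => sN _ _.
  by rewrite expgnA conjXg; apply: subgroupX sN Nn.
move/(_ (lam (1 * d^-1) d 0%R)); rewrite lam_conj.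
  rewrite mulnC mul1g lamp => /(can_inj (holonomyK lamP _ _)).
  by rewrite /id; lia.
rewrite mul1g invgK expgnA conjXg; exact: subgroupX deckP kn.
Qed.

End Separation.

(** * Choice of the quotient and failure of the extension property *)

Lemma S_subgroup_witness (F : groupType) (H : set F) :
  is_subgroup H -> S_subgroup H ->
  exists w f, [/\ H w, H (w ^ f) & forall h, H h -> w ^ f <> w ^ h].
Proof.
move=> sH [w Hw neq]; apply: contrapT => nex; apply: neq.
apply/seteqP; split=> [_ [h Hh <-]|_ [[f _ <-] Hf]].
  by split; [exists h|apply: subgroupJ].
apply: contrapT => nconj; apply: nex; exists w, f; split => // h Hh e.
by apply: nconj; exists h.
Qed.

Lemma normal_closure_conj (F : groupType) (N : set F) x f :
  N x -> normal_closure N (x ^ f).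
Proof. by move=> Nx M [[_ _ nM] NM]; apply: nM => //; apply: NM. Qed.

Lemma separating_subgroup (F : groupType) (X H : set F) (w f : F) (Phi : seq F) :
    is_basis X -> is_subgroup H -> H w -> H (w ^ f) ->
    (forall h, H h -> w ^ f <> w ^ h) ->
  exists (N : set F) n,
    [/\ is_normal_subgroup H N, {in Phi, forall x, N x -> x = 1},
        N (w ^+ n) & ~ N (w ^+ n ^ f)].
Proof.
move=> basisX sH Hw Hwf nconj.
have w1 : w <> 1 by move=> w1; apply: (nconj 1 (subgroup1 sH)); rewrite w1 !conj1g.
have [r [k [c [primr ew]]]] := primitive_root basisX w1.
set rho := word_val r in ew; pose prefix a := word_val (take a r).
pose m := size r; pose d := c * f.
have conj_c n : rho ^+ (k.+1 * n) ^ c = w ^+ n by rewrite expgnA conjXg -ew.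
have conj_d n : rho ^+ (k.+1 * n) ^ d = w ^+ n ^ f by rewrite conjgM conj_c.
(* Otherwise [f] would be an element centralizing [w] times [h^-1], making [w ^ f] conjugate to [w]
   in [H]. *)
have cosets_neq h i : H h -> d^-1 <> h * (c^-1 * rho ^+ i).
  move=> Hh e; apply: (nconj h^-1 (subgroupV sH Hh)).
  have -> : f = c^-1 * (rho ^- i * (c * h^-1)).
    by rewrite -[LHS](mulKg c) -/d -[d]invgK e !invgM invgK !mulgA.
  have fix_rho : rho ^+ k.+1 ^ rho ^- i = rho ^+ k.+1.
    apply/conjg_fixP/commgP/commuteV; exact: commuteX2.
  by rewrite {1}ew -conjgM mulVKg !conjgM fix_rho -ew.
(* Commutators surviving in [Q] let commutation there be lifted to [F]. *)
pose D := Phi ++ rho :: [seq [~ prefix a, rho] | a <- iota 0 m] ++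
  [seq [~ prefix a * rho * (prefix b)^-1, rho] | a <- iota 0 m, b <- iota 0 m].
have [Q [q [n [qM n0 qn qD]]]] := residually_finite basisX D.
have comm_lift x y : [~ x, y] \in D -> commute (q x) (q y) -> commute x y.
  move=> xyD /commgP/eqP qxy; apply/commgP/eqP/qD => //.
  by rewrite -qxy /commg /conjg !(qM, morphV qM).
have q_rho : q rho <> 1.
  move=> /qD rho1; apply: w1; rewrite ew rho1 ?expg1n ?conj1g //.
  by rewrite /D mem_cat inE eqxx orbT.
have q_prefix a : a < m -> commute (q (prefix a)) (q rho) -> a = 0.
  move=> am /comm_lift ca; apply: (primitive_prefix basisX primr am); apply: ca.
  rewrite /D mem_cat inE mem_cat (map_f (fun a => [~ prefix a, rho])) ?orbT //.
  by rewrite mem_iota.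
have q_double a b : a < m -> b < m ->
    commute (q (prefix a) * q rho * (q (prefix b))^-1) (q rho) -> a = 0 /\ b = 0.
  move=> am bm; rewrite -(morphV qM) -!qM => /comm_lift cab.
  apply: (primitive_double_coset basisX primr am bm); apply: cab.
  rewrite /D mem_cat inE mem_cat.
  by rewrite (allpairs_f (fun a b => [~ prefix a * rho * (prefix b)^-1, rho])) ?orbT ?mem_iota.
have [lam lamP] := holonomy_exists basisX (labelK H r d q) (labelV H r d q).
have deck_power x : H x -> deck H q (x ^+ n).
  by move=> Hx; split; [apply: subgroupX|rewrite morphX].
have deck_c : deck H q (rho ^+ (k.+1 * n) ^ c) by rewrite conj_c; apply: deck_power.
have deck_d : deck H q (rho ^+ (k.+1 * n) ^ d).
  by rewrite conj_d conjXg; apply: deck_power.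
(* The factor [n] brings the powers into the kernel of [q]; the factor 2 kills the involutive
   holonomy. *)
exists (separating_normal H q lam), (n * 2)%N; split.
- exact: separating_normalP lamP.
- by move=> x xPhi [[_ qx] _]; apply: qD => //; rewrite /D mem_cat xPhi.
- by rewrite -conj_c mulnA; apply: (separating_normal_rho _ _ primr _ _ _ lamP).
- rewrite -conj_d mulnA; apply: (separating_normal_rho_conj _ _ primr _ _ _ lamP) => //.
  + by exists (k.+1 * n)%N; rewrite ?muln_gt0.
  + by rewrite muln_gt0 muln_gt0 n0.
  + by rewrite expgnA conjXg; apply: subgroupX deck_d; apply: deckP.
Qed.

Theorem proposition1 (F : groupType) (H : set F) :
  is_free F -> is_subgroup H -> finitely_generated H ->
  S_subgroup H -> ~ ACEP H.
Proof.
move=> [X basisX] sH _ /(S_subgroup_witness sH)[w [f [Hw Hwf nconj]]].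
move=> [Phi [/finite_seqP[s ->] _ s1 acep]].
have [N [n [nN Ns Nw Nwf]]] := separating_subgroup s basisX sH Hw Hwf nconj.
(* [w ^+ n ^ f] lies in [H] and in the normal closure of [N], so the extension property would put it
   in [N]. *)
apply: Nwf; rewrite -(acep N nN).
  split; last exact: normal_closure_conj.
  by rewrite conjXg; apply: subgroupX.
by rewrite -subset0 => x [Nx /= xs]; apply: s1; rewrite /= -(Ns x).
Qed.
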